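(* Let $(W,S)$ be a Coxeter system and let $r$ be a real number. (1) Let $n\ge 2$ and assume that there are distinct generators $s_0,s_1,\dots,s_n\in S$ such that $s_0s_k\ne s_ks_0$ (i.e. $m(s_0,s_k)>2$) for $1\le k\le n$. If the function $w\mapsto r^{\|w\|}$ is positive definite on $W$, then $\frac{-1}{n-1}\le r^3\le 1$. (2) If there is an element $s_0\in S$ for which there are infinitely many $s\in S$ such that $s_0s\neq ss_0$, then $w\mapsto r^{\|w\|}$ is positive definite on $W$ if and only if $0\le r\le 1$.
   Context: A Coxeter system $(W,S)$ is a group $W$ with a (possibly infinite) generating set $S$ and presentation $W=\langle S\mid (s_1s_2)^{m(s_1,s_2)}=1 \text{ whenever } m(s_1,s_2)\neq\infty\rangle$, where $m\colon S\times S\to\{1,2,\dots,\infty\}$ is symmetric and $m(s_1,s_2)=1$ iff $s_1=s_2$. For $w\in W$ the colour $S_w\subseteq S$ is the (finite) set of generators occurring in a reduced word (word of minimal length in $S$) of $w$; it does not depend on the reduced word. The colour-length is $\|w\|=\#S_w$. A function $\varphi\colon W\to\mathbb{C}$ is positive definite if $\sum_{x,y\in W}\varphi(y^{-1}x)\alpha(x)\overline{\alpha(y)}\ge 0$ for every finitely supported $\alpha\colon W\to\mathbb{C}$. Convention: $0^0=1$. *)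

(* Defs.v *)
From HB Require Import structures.
From mathcomp Require Import all_boot all_order all_algebra.
From mathcomp Require Import finmap.
From mathcomp Require Import boolp classical_sets functions cardinality reals.
From mathcomp Require Import complex.

Set Implicit Arguments.
Unset Strict Implicit.
Unset Printing Implicit Defensive.

Import Order.TTheory GRing.Theory Num.Theory.

Local Open Scope classical_set_scope.

(* [Some k] stands for the finite value k, [None] for infinity. *)
Definition is_coxeter_matrix (I : Type) (m : I -> I -> option nat) : Prop :=
  [/\ forall s t, m s t <> Some 0,
      forall s t, m s t = m t s
    & forall s t, m s t = Some 1 <-> s = t].

(* Group words over I: [(s, false)] is the letter s and [(s, true)] the letter
   s^-1.  Modulo [presents_cancel] alone these words form the free group on I;
   [presents_rel] makes the congruence that of the quotient of this free group
   by the normal closure of [Rel]. *)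
Inductive presents (I : Type) (Rel : set (seq (I * bool))) :
    seq (I * bool) -> seq (I * bool) -> Prop :=
| presents_refl u : presents Rel u u
| presents_sym u v : presents Rel u v -> presents Rel v u
| presents_trans u v w :
    presents Rel u v -> presents Rel v w -> presents Rel u w
| presents_cancel u v s b :
    presents Rel (u ++ [:: (s, b); (s, ~~ b)] ++ v) (u ++ v)
| presents_rel u v r : Rel r -> presents Rel (u ++ r ++ v) (u ++ v).

Definition group_word_value (W : groupType) (S : set W)
    (u : seq (S * bool)) : W :=
  (\big[*%g/1]_(l <- u) (if l.2 then (val l.1)^-1 else val l.1))%g.

(* W = < S | Rel >: S generates W, and two group words over S have the same
   value in W only when the relations in Rel force it. *)
Definition has_presentation (W : groupType) (S : set W)
    (Rel : set (seq (S * bool))) : Prop :=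
  (forall w : W, exists u : seq (S * bool), group_word_value u = w) /\
  (forall u v : seq (S * bool), group_word_value u = group_word_value v <-> presents Rel u v).

Definition coxeter_relators (I : Type) (m : I -> I -> option nat) :
    set (seq (I * bool)) :=
  [set r | exists s t k, m s t = Some k /\
     r = flatten (nseq k [:: (s, false); (t, false)])].

Definition is_coxeter_system (W : groupType) (S : set W)
    (m : S -> S -> option nat) : Prop :=
  is_coxeter_matrix m /\ has_presentation (coxeter_relators m).

(* Words in the letters S alone suffice here, the generators of a Coxeter system
   being involutions. *)
Definition word_value (W : groupType) (S : set W) (u : seq S) : W :=
  (\big[*%g/1]_(s <- u) val s)%g.

Definition is_reduced_word (W : groupType) (S : set W) (w : W) (u : seq S) :
    Prop :=
  word_value u = w /\ forall v : seq S, word_value v = w -> size u <= size v.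

(* Some reduced word of w (the empty word if there is none, which does not occur
   when S is the generating set of a Coxeter system). *)
Definition reduced_word (W : groupType) (S : set W) (w : W) : seq S :=
  xget [::] [set u | is_reduced_word w u].

(* In a Coxeter system this does not depend on the chosen reduced word. *)
Definition colour (W : groupType) (S : set W) (w : W) : {fset S} :=
  [fset s in reduced_word S w]%fset.

Definition colour_length (W : groupType) (S : set W) (w : W) : nat :=
  #|` colour S w|.

Definition positive_definite (R : realType) (W : groupType) (phi : W -> R[i]) :
    Prop :=
  forall alpha : {fsfun W -> R[i] for fun=> 0%R},
    (0 <= \sum_(x <- finsupp alpha) \sum_(y <- finsupp alpha)
            phi (y^-1 * x)%g * alpha x * (alpha y)^*)%R.

Definition colour_power (R : realType) (W : groupType) (S : set W) (r : R) :
    W -> R[i] :=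
  fun w => (r ^+ colour_length S w)%:C%C%R.

(* Main.v *)
Require Import Defs.
From HB Require Import structures.
From mathcomp Require Import all_boot all_order all_algebra.
From mathcomp Require Import finmap.
From mathcomp Require Import boolp classical_sets functions cardinality reals.
From mathcomp Require Import complex.

Set Implicit Arguments.
Unset Strict Implicit.
Unset Printing Implicit Defensive.

(** Both parts rest on one fact about colours: if [w] is the value of a word
[v], then every letter of the colour of [w] occurs in [v] ([colour_sub]).  Thus
the elements whose colour avoids a given set of generators form a subgroup.

The fact is proved from the presentation alone.  To a word [s_1 ... s_k] attach
the sequence of reflections [s_1 ... s_(i-1) s_i s_(i-1) ... s_1].  The parity
of the number of occurrences of a given reflection does not change when a
relator is inserted or removed, since each reflection occurs an even number of
times in the sequence of a relator [(st)^k]; hence this parity depends only on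
the value of the word ([odd_count_reflections]).  If a reflection is repeated,
then letters can be deleted from the word ([deletion]), so the reduced words are
exactly those without repetition, and their reflections occur in the sequence of
every other word with the same value.

Sufficiency of [0 <= r <= 1]: choose a random set of generators containing each
generator independently with probability [r].  Then [r ^ ||w||] is the
probability that the colour of [w] is contained in this set, so it is an average
of indicator functions of subgroups, and these are positive definite
([subgroup_form_ge0]).  Only finitely many generators matter for a finitely
supported coefficient function, and the average is taken one generator at a time
([partial_colour_weight_ge0]).

Necessity: put [x_k = s_k s_0].  For [j <> k] the element
[x_j^-1 x_k = s_0 s_j s_k s_0] has colour [{s_0, s_j, s_k}]
([colour_length_star]), so the Gram matrix of [x_1, ..., x_n] is
[(1 - r^3) I + r^3 J] with [J] the all-ones matrix.  Its eigenvalues [1 - r^3]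
and [1 + (n - 1) r^3] must be nonnegative, which gives the two bounds
([star_bounds]).  With infinitely many [s_k], letting [n] grow gives
[0 <= r^3 <= 1]. *)

(** * The reflections of a word *)

Section Words.
Local Open Scope group_scope.
Context (W : groupType) (S : set W).
Implicit Types (s t : S) (u v : seq S) (x y w : W).

Lemma word_value_nil : word_value ([::] : seq S) = 1.
Proof. by rewrite /word_value big_nil. Qed.

Lemma word_value_cons s u : word_value (s :: u) = val s * word_value u.
Proof. by rewrite /word_value big_cons. Qed.

Lemma word_value_cat u v : word_value (u ++ v) = word_value u * word_value v.
Proof. by rewrite /word_value big_cat. Qed.

Lemma word_value_seq1 s : word_value [:: s] = val s.
Proof. by rewrite word_value_cons word_value_nil mulg1. Qed.

(** The sequence of the [s_1 ... s_(i-1) s_i (s_1 ... s_(i-1))^-1].  For a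
reduced word these are the reflections of the hyperplanes that separate the
fundamental chamber from its image. *)
Fixpoint reflections u : seq W :=
  if u is s :: u' then val s :: [seq val s * x * (val s)^-1 | x <- reflections u']
  else [::].

Lemma size_reflections u : size (reflections u) = size u.
Proof. by elim: u => //= s u IH; rewrite size_map IH. Qed.

Lemma conj_inj w : injective (fun x : W => w * x * w^-1).
Proof. by move=> x y /mulIg /mulgI. Qed.

Lemma reflections_cat u v :
  reflections (u ++ v) =
  reflections u ++ [seq word_value u * x * (word_value u)^-1 | x <- reflections v].
Proof.
elim: u => [|s u IH] /=.
  rewrite word_value_nil -[LHS]map_id; apply: eq_map => x.
  by rewrite mul1g invg1 mulg1.
rewrite IH map_cat; congr (_ :: _ ++ _); rewrite -map_comp; apply: eq_map => x /=.
by rewrite word_value_cons invgM !mulgA.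
Qed.

Lemma count_reflections_cat u v x :
  count_mem x (reflections (u ++ v)) =
  (count_mem x (reflections u) +
   count_mem ((word_value u)^-1 * x * word_value u)%g (reflections v))%N.
Proof.
rewrite reflections_cat count_cat count_map; congr (_ + _)%N.
apply: eq_count => y /=; apply/eqP/eqP => [<-|->].
  by rewrite !mulgA mulVg mul1g mulgVK.
by rewrite !mulgA mulgV mul1g mulgK.
Qed.


End Words.

Section CoxeterSystem.
Local Open Scope group_scope.
Context (W : groupType) (S : set W) (m : S -> S -> option nat).
Hypothesis hW : is_coxeter_system m.
Implicit Types (s t : S) (u v : seq S) (x y w : W).

(** The diagonal entry [m s s = 1] makes [ss] itself a relator. *)
Lemma generator_sqr s : val s * val s = 1.
Proof.
case: hW => -[_ _ m1] [_ pres].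
have : group_word_value [:: (s, false); (s, false)] =
         group_word_value ([::] : seq (S * bool)).
  apply/pres.
  apply: (@presents_rel _ _ [::] [::] [:: (s, false); (s, false)]).
  by exists s, s, 1%N; split => //; apply/m1.
by rewrite /group_word_value !big_cons big_nil mulg1.
Qed.

Lemma generatorV s : (val s)^-1 = val s.
Proof. by rewrite -[RHS](mulKg (val s)) generator_sqr mulg1. Qed.

Lemma group_word_value_forget (u : seq (S * bool)) :
  group_word_value u = word_value (map fst u).
Proof.
elim: u => [|[s b] u IH]; first by rewrite /group_word_value /word_value !big_nil.
rewrite /= word_value_cons -IH /group_word_value big_cons /=.
by case: b; rewrite ?generatorV.
Qed.

Lemma word_value_alternating s t k :
  word_value (flatten (nseq k [:: s; t])) = (val s * val t) ^+ k.
Proof.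
elim: k => [|k IH]; first exact: word_value_nil.
by rewrite /= !word_value_cons IH expgS mulgA.
Qed.

(** Every alternating word [st...s] of odd length [2i+1] with [i < 2k] occurs
once.  When [(st)^k = 1] the exponent [i] matters only modulo [k], so the second
half of the sequence repeats the first. *)
Lemma reflections_alternating s t k :
  reflections (flatten (nseq k [:: s; t])) =
  [seq (val s * val t) ^+ i * val s | i <- iota 0 (k + k)].
Proof.
elim: k => [//|k IH].
rewrite addSn addnS /= mul1g expg1 generatorV IH; congr [:: _, _ & _].
rewrite (iotaDl 2 0) -!map_comp; apply: eq_map => i /=.
by rewrite [in RHS]expgS [in RHS]expgSr !generatorV !mulgA.
Qed.

(** The invariance of the parity is checked on each rule that generates the
congruence: inserting a word [b] of value [1] into [a ++ c] only adds the
conjugates of the reflections of [b], and these come in pairs. *)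
Lemma odd_count_reflections_presents (u v : seq (S * bool)) :
  presents (coxeter_relators m) u v -> forall x,
  odd (count_mem x (reflections (map fst u))) =
  odd (count_mem x (reflections (map fst v))).
Proof.
have insert_trivial (a b c : seq S) : word_value b = 1 ->
    (forall x, ~~ odd (count_mem x (reflections b))) ->
  forall x, odd (count_mem x (reflections (a ++ b ++ c))) =
            odd (count_mem x (reflections (a ++ c))).
  move=> b1 even_b x; rewrite !count_reflections_cat b1 !oddD.
  by rewrite (negbTE (even_b _)) invg1 mul1g mulg1.
elim=> {u v} [//|u v _ IH x|u v w _ IHu _ IHv x|u v s b|u v r] //.
- by rewrite IHu.
- rewrite !map_cat; apply: insert_trivial => [|x] /=.
    by rewrite !word_value_cons word_value_nil mulg1 generator_sqr.
  by rewrite mulgK addn0 addnn odd_double.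
- move=> rel_r; rewrite !map_cat.
  have r1 : word_value (map fst r) = 1.
    rewrite -group_word_value_forget.
    rewrite -[RHS](_ : group_word_value ([::] : seq (S * bool)) = 1);
      last by rewrite /group_word_value big_nil.
    case: hW => _ [_ pres]; apply/pres; rewrite -[r]cats0.
    exact: (@presents_rel _ _ [::] [::]).
  apply: insert_trivial => // x; case: rel_r r1 => s [t] [k] [_ ->].
  rewrite map_flatten map_nseq /= word_value_alternating reflections_alternating.
  move=> stk; rewrite iotaD add0n map_cat.
  have -> : iota k k = [seq (k + i)%N | i <- iota 0 k] by rewrite -iotaDl addn0.
  rewrite -map_comp count_cat.
  rewrite (_ : map _ _ = [seq (val s * val t) ^+ i * val s | i <- iota 0 k]).
    by rewrite addnn odd_double.
  by apply: eq_map => i /=; rewrite expgnDr stk mul1g.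
Qed.

Lemma odd_count_reflections u v x : word_value u = word_value v ->
  odd (count_mem x (reflections u)) = odd (count_mem x (reflections v)).
Proof.
pose pos := map (fun s => (s, false)).
have posK a : map fst (pos a) = a by rewrite -map_comp map_id.
move=> uv; rewrite -[u]posK -[v]posK; apply: odd_count_reflections_presents.
by case: hW => _ [_ pres]; apply/pres; rewrite !group_word_value_forget !posK.
Qed.

Lemma uniq_reflections_sub u v : uniq (reflections u) ->
  word_value u = word_value v -> {subset reflections u <= reflections v}.
Proof.
move=> uniq_u uv x xu; have := odd_count_reflections x uv.
rewrite count_uniq_mem // xu => /esym odd_v.
by rewrite -has_pred1 has_count; case: (count _ _) odd_v.
Qed.

(** * Deletion and the support of reduced words *)

(** Multiplying by the [i]-th reflection of a word deletes its [i]-th letter. *)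
Lemma reflection_exchange u x : x \in reflections u ->
  exists v, [/\ subseq v u, (size v < size u)%N &
    x * word_value u = word_value v].
Proof.
elim: u x => [//|s u IH] x /=.
rewrite inE => /predU1P[->|/mapP[y /IH[v [vu szv yu]] ->]].
  exists u; split=> //; first exact: subseq_cons.
  by rewrite word_value_cons mulgA generator_sqr mul1g.
exists (s :: v); split=> //=; first by rewrite eqxx.
by rewrite !word_value_cons -yu !mulgA mulgVK.
Qed.

(** If the head [s] of [s :: u] reappears later in the reflections, then [s] is
itself a reflection of [u] (conjugation by [s] fixes [s]), so multiplying [u] by
[s] deletes a letter of [u] instead of adding one. *)
Lemma deletion u : ~~ uniq (reflections u) ->
  exists v, [/\ subseq v u, (size v < size u)%N &
    word_value u = word_value v].
Proof.
elim: u => [//|s u IH]; rewrite /= negb_and negbK map_inj_uniq; last exact: conj_inj.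
case/orP=> [/mapP[y yu sy]|/IH[v [vu szv uv]]]; last first.
  exists (s :: v); split=> //=; first by rewrite eqxx.
  by rewrite !word_value_cons uv.
have {sy} ys : y = val s.
  by apply: (@conj_inj _ (val s)); rewrite -sy mulgK.
have [v [vu szv sv]] := reflection_exchange yu.
exists v; split; first exact: subseq_trans vu (subseq_cons _ _).
  exact: ltnW.
by rewrite word_value_cons -ys.
Qed.

Lemma uniq_reflections_subword u :
  exists v, [/\ subseq v u, uniq (reflections v) & word_value u = word_value v].
Proof.
have [n] := ubnP (size u); elim: n u => [//|n IH] u; rewrite ltnS => szu.
have [uniq_u|/deletion[v [vu szv uv]]] := boolP (uniq (reflections u)).
  by exists u.
have [|v' [v'v uniq_v' vv']] := IH v; first exact: leq_trans szv szu.
by exists v'; split; rewrite ?uv //; apply: subseq_trans v'v vu.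
Qed.

(** The distinct reflections of [u] all occur among those of any other word for
the same element, and a word has as many reflections as letters. *)
Lemma uniq_reflections_reduced u :
  uniq (reflections u) -> is_reduced_word (word_value u) u.
Proof.
move=> uniq_u; split=> // v /esym vu.
rewrite -(size_reflections u) -(size_reflections v).
exact: uniq_leq_size (uniq_reflections_sub _ _).
Qed.

Lemma reduced_uniq_reflections w u :
  is_reduced_word w u -> uniq (reflections u).
Proof.
case=> <- min_u; apply/negPn/negP => /deletion[v [_ szv uv]].
by have := min_u v (esym uv); rewrite leqNgt szv.
Qed.

Lemma generator_neq1 s : val s <> 1.
Proof.
rewrite -word_value_seq1 -(word_value_nil S) => /(odd_count_reflections (val s)).
by rewrite /= eqxx.
Qed.

(** A generator lies in the subgroup generated by a set of generators only if it
is one of them: deleting letters from [v] leaves a single letter. *)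
Lemma generator_mem_word s v : val s = word_value v -> s \in v.
Proof.
have [v' [v'v /uniq_reflections_reduced[_ min_v'] ->]] :=
  uniq_reflections_subword v.
move=> sv'; have := min_v' [:: s]; rewrite word_value_seq1 => /(_ sv').
case: v' v'v sv' {min_v'} => [|a []] // v'v.
  by rewrite word_value_nil => /generator_neq1.
by rewrite word_value_seq1 => /val_inj ->; rewrite -sub1seq.
Qed.

Lemma word_value_rev u : word_value (rev u) = (word_value u)^-1.
Proof.
elim: u => [|s u IH]; first by rewrite word_value_nil invg1.
rewrite rev_cons -cats1 word_value_cat word_value_seq1 word_value_cons.
by rewrite invgM IH generatorV.
Qed.

Lemma reflection_word u x : x \in reflections u ->
  exists2 v, word_value v = x & {subset v <= u}.
Proof.
elim: u x => [//|s u IH] x /=.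
rewrite inE => /predU1P[->|/mapP[y /IH[v <- vu] ->]].
  by exists [:: s]; [exact: word_value_seq1|move=> a; rewrite !inE => ->].
exists (s :: rcons v s) => [|a].
  by rewrite word_value_cons -cats1 word_value_cat word_value_seq1 generatorV mulgA.
by rewrite inE mem_rcons !inE orbA orbb => /orP[->//|/vu ->]; rewrite orbT.
Qed.

(** The first letter [s] of [u] is a reflection of [u], hence of [v], hence a
product of letters of [v], hence a letter of [v].  The remaining letters of [u]
form a word for the value of [s :: v], whose letters are those of [v], so
induction applies. *)
Lemma reduced_letters_sub u v : uniq (reflections u) ->
  word_value u = word_value v -> {subset u <= v}.
Proof.
elim: u v => [//|s u IH] v uniq_su suv.
have sv : s \in v.
  have /reflection_word[v' v's v'v] : val s \in reflections v.
    by apply: uniq_reflections_sub suv _ _; rewrite //= inE eqxx.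
  by apply: v'v; apply: generator_mem_word.
have /IH sub_u : uniq (reflections u).
  by move: uniq_su => /= /andP[_]; rewrite map_inj_uniq //; apply: conj_inj.
have {}/sub_u sub_u : word_value u = word_value (s :: v).
  by rewrite word_value_cons -suv word_value_cons mulgA generator_sqr mul1g.
by move=> a; rewrite inE => /predU1P[->//|/sub_u]; rewrite inE => /predU1P[->|].
Qed.

Lemma reduced_wordP w : is_reduced_word w (reduced_word S w).
Proof.
have [u uw] : exists u : seq S, word_value u = w.
  case: hW => _ [gen _]; have [u <-] := gen w.
  by exists (map fst u); rewrite group_word_value_forget.
have [v [_ /uniq_reflections_reduced vred uv]] := uniq_reflections_subword u.
by apply: (xgetPex [::]); exists v; rewrite -uw uv; apply: vred.
Qed.

Lemma word_value_reduced_word w : word_value (reduced_word S w) = w.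
Proof. by case: (reduced_wordP w). Qed.

Lemma colour_sub w v : w = word_value v -> {subset colour S w <= v}.
Proof.
move=> wv a; rewrite inE /=; have red_w := reduced_wordP w.
apply: reduced_letters_sub; first exact: reduced_uniq_reflections red_w.
by rewrite -wv; case: red_w.
Qed.

(** * Colours of products *)

Lemma mem_colour w s : (s \in colour S w) = (s \in reduced_word S w).
Proof. by rewrite inE. Qed.

Lemma colour_lengthE w : colour_length S w = size (undup (reduced_word S w)).
Proof. by rewrite /colour_length /colour card_fseq. Qed.

Lemma colour1 s : s \notin colour S 1.
Proof.
apply/negP => /(colour_sub (v := [::])).
by rewrite word_value_nil => /(_ erefl).
Qed.

Lemma colour_length1 : colour_length S (1 : W) = 0%N.
Proof.
rewrite colour_lengthE; case E: (reduced_word S 1) => [//|s u].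
by have := colour1 s; rewrite mem_colour E inE eqxx.
Qed.

Lemma colourM x y s :
  s \in colour S (x * y) -> (s \in colour S x) || (s \in colour S y).
Proof.
rewrite !(mem_colour _ s) -mem_cat -mem_colour; apply: colour_sub.
by rewrite word_value_cat !word_value_reduced_word.
Qed.

Lemma colourV x s : s \in colour S x^-1 -> s \in colour S x.
Proof.
rewrite (mem_colour x) -(mem_rev (reduced_word S x)); apply: colour_sub.
by rewrite word_value_rev word_value_reduced_word.
Qed.

Lemma word_value_nseq n s : word_value (nseq n s) = if odd n then val s else 1.
Proof.
elim: n => [|n IH]; first exact: word_value_nil.
by rewrite /= word_value_cons IH; case: odd; rewrite /= ?generator_sqr ?mulg1.
Qed.

(** The common value of the two conjugates of [s] has its colour contained in
both [{s, a}] and [{s, b}], hence in [{s}].  So it is [s] or [1], and it is not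
[1] because [s] is not. *)
Lemma commute_of_conj_eq s a b : s != a -> s != b -> a != b ->
  val a * val s * val a = val b * val s * val b ->
  val s * val a = val a * val s.
Proof.
move=> sa sb ab conj_eq; pose c := val a * val s * val a.
have c_word (d : S) : c = val d * val s * val d ->
    {subset reduced_word S c <= [:: d; s; d]}.
  move=> cd e; rewrite -mem_colour; apply: colour_sub.
  by rewrite !word_value_cons word_value_nil mulg1 mulgA.
have /all_pred1P red_c : all (pred1 s) (reduced_word S c).
  apply/allP => e ec; have := c_word a erefl e ec; have := c_word b conj_eq e ec.
  rewrite !inE /=; case: (e == s) => //; rewrite orbb orbb => /eqP -> /eqP ba.
  by rewrite ba eqxx in ab.
have := word_value_reduced_word c; rewrite red_c word_value_nseq.
case: odd => [sc|/esym c1].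
  by rewrite [in RHS]sc /c !mulgA generator_sqr mul1g.
case: (@generator_neq1 s).
have : val a * c * val a = 1 by rewrite c1 mulg1 generator_sqr.
by rewrite /c !mulgA generator_sqr mul1g -mulgA generator_sqr mulg1.
Qed.

(** The word [sabs] need not be shown to be reduced: it suffices that each of
[s], [a] and [b] occurs in every word for [w].  This is clear for [a] and [b],
since each of them can be solved for in terms of [w] and the other two.  If [s]
could be avoided, then a reduced subword of [sabs] would have to be [ab], so [s]
would commute with [ab]; this means [asa = bsb], whence [s] commutes with [a]. *)
Lemma colour_length_star s a b : s != b -> a != b ->
  val s * val a <> val a * val s ->
  colour_length S (val s * val a * val b * val s) = 3.
Proof.
move=> sb ab ncomm; set w := _ * val s.
have sa : s != a by apply: contra_notN ncomm => /eqP ->.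
have w_word : w = word_value [:: s; a; b; s].
  by rewrite !word_value_cons word_value_nil mulg1 !mulgA.
have a_mem v : w = word_value v -> a \in v.
  move=> wv; have : val a = word_value (s :: v ++ [:: s; b]).
    rewrite word_value_cons word_value_cat -wv !word_value_cons word_value_nil.
    rewrite mulg1 /w !mulgA generator_sqr mul1g.
    rewrite -(mulgA _ (val s) (val s)) generator_sqr mulg1.
    by rewrite -mulgA generator_sqr mulg1.
  move/generator_mem_word; rewrite inE mem_cat !inE eq_sym.
  by rewrite (negbTE sa) (negbTE ab) !orbF.
have b_mem v : w = word_value v -> b \in v.
  move=> wv; have : val b = word_value (a :: s :: v ++ [:: s]).
    rewrite !word_value_cons word_value_cat -wv word_value_seq1 /w.
    rewrite -(mulgA _ (val s) (val s)) generator_sqr mulg1 !mulgA.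
    rewrite -(mulgA _ (val s) (val s)) generator_sqr mulg1.
    by rewrite generator_sqr mul1g.
  move/generator_mem_word; rewrite !inE mem_cat !inE ![b == _]eq_sym.
  by rewrite (negbTE sb) (negbTE ab) !orbF.
have s_mem v : w = word_value v -> s \in v.
  move=> wv; apply/negPn/negP => s'v.
  have [v' [v'sub v'uniq wv']] := uniq_reflections_subword [:: s; a; b; s].
  have v'v : {subset v' <= v}.
    by apply: reduced_letters_sub; rewrite // -wv' -w_word.
  rewrite -w_word in wv'.
  have {}v'sub : subseq v' [:: a; b].
    have -> : [:: a; b] = filter (predC1 s) [:: s; a; b; s].
      by rewrite /= eqxx /= ![_ == s]eq_sym (negbTE sa) (negbTE sb).
    rewrite subseq_filter v'sub andbT; apply/allP => e /v'v ev /=.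
    by apply: contraNneq s'v => <-.
  have v'E : v' = [:: a; b].
    apply/eqP; rewrite -(size_subseq_leqif v'sub) eqn_leq size_subseq //=.
    apply: (@uniq_leq_size _ [:: a; b]); first by rewrite /= inE ab.
    by move=> e; rewrite !inE => /orP[]/eqP ->; [apply: a_mem|apply: b_mem].
  apply: ncomm; apply: (@commute_of_conj_eq s a b) => //.
  have wab : w = val a * val b.
    by rewrite wv' v'E !word_value_cons word_value_nil mulg1.
  (* Multiplying [sabs = ab] by [a] on the left and by [sb] on the right and
     cancelling squares gives [asa = bsb]. *)
  have : val a * w * val s * val b = val a * (val a * val b) * val s * val b.
    by rewrite wab.
  rewrite /w !mulgA generator_sqr mul1g.
  rewrite -(mulgA _ (val s) (val s)) generator_sqr mulg1.
  by rewrite -(mulgA _ (val b) (val b)) generator_sqr mulg1.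
rewrite colour_lengthE -[RHS]/(size [:: s; a; b]).
apply: perm_size; apply: uniq_perm.
- exact: undup_uniq.
- by rewrite /= !inE negb_or sa sb ab.
move=> e; rewrite mem_undup -mem_colour; apply/idP/idP.
  by move/(colour_sub w_word); rewrite !inE; case: (e == s) => //=; rewrite orbF.
have w_red := esym (word_value_reduced_word w).
rewrite mem_colour !inE.
by case/or3P=> /eqP ->; [apply: s_mem|apply: a_mem|apply: b_mem].
Qed.

End CoxeterSystem.

Import Order.TTheory GRing.Theory Num.Theory.

(** * Positive definite functions *)

Section PositiveDefinite.
Local Open Scope ring_scope.
Context (R : realType) (W : groupType).
Implicit Types (phi : W -> R[i]) (A : seq W) (a : W -> R[i]).

Definition hermitian_form phi A a : R[i] :=
  \sum_(x <- A) \sum_(y <- A) phi (y^-1 * x)%g * a x * (a y)^*.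

(** The form is the sum, over the left cosets of [H], of the squared modulus of
the sum of [a] over the coset.  The coset of [x] is encoded by the position in
[A] of its first representative; [size A], the value of [find] on failure, is
included in the range of indices to save a case distinction. *)
Lemma subgroup_form_ge0 (H : pred W) A a :
    H 1%g -> (forall x y, H x -> H y -> H (x * y)%g) ->
    (forall x, H x -> H x^-1%g) ->
  0 <= hermitian_form (fun w => (H w)%:R) A a.
Proof.
move=> H1 HM HV; pose cls x := find (fun z => H (z^-1 * x)%g) A.
have cls_eq x y : x \in A -> H (y^-1 * x)%g = (cls x == cls y).
  move=> xA; apply/idP/eqP => [Hyx|].
    apply: eq_find => z /=; apply/idP/idP => [Hzx|Hzy].
      have -> : (z^-1 * y = (z^-1 * x) * (y^-1 * x)^-1)%g.
        by rewrite invgM invgK !mulgA mulgK.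
      by apply: HM => //; apply: HV.
    have -> : (z^-1 * x = (z^-1 * y) * (y^-1 * x))%g by rewrite !mulgA mulgK.
    exact: HM.
  have hasx : has (fun z => H (z^-1 * x)%g) A.
    by apply/hasP; exists x => //; rewrite mulVg.
  move=> xy; have hasy : has (fun z => H (z^-1 * y)%g) A.
    by rewrite has_find -[find _ _]xy -has_find.
  have := nth_find 1%g hasy; have := nth_find 1%g hasx.
  rewrite -/(cls x) -/(cls y) xy; set z := nth _ _ _ => Hzx Hzy.
  have -> : (y^-1 * x = (z^-1 * y)^-1 * (z^-1 * x))%g.
    by rewrite invgM invgK !mulgA mulgK.
  by apply: HM => //; apply: HV.
have -> : hermitian_form (fun w => (H w)%:R) A a =
    \sum_(i < (size A).+1) (\sum_(x <- A) (cls x == i)%:R * a x) *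
                           (\sum_(x <- A) (cls x == i)%:R * a x)^*.
  under eq_bigr => i _ do rewrite rmorph_sum /= mulr_suml.
  rewrite exchange_big /= /hermitian_form big_seq [RHS]big_seq.
  apply: eq_bigr => x xA.
  under [RHS]eq_bigr => i _ do rewrite mulr_sumr.
  rewrite exchange_big /=; apply: eq_bigr => y _.
  have cls_lt : (cls x < (size A).+1)%N by rewrite ltnS find_size.
  rewrite (bigD1 (Ordinal cls_lt)) //= eqxx mul1r big1 ?addr0 => [|i].
    by rewrite rmorphM rmorph_nat /= cls_eq // eq_sym -!mulrA; apply: mulrCA.
  by rewrite -val_eqE /= eq_sym => /negbTE ->; rewrite !mul0r.
by apply: sumr_ge0 => i _; apply: mul_conjC_ge0.
Qed.

(** Coefficients on an injective family instead of a finitely supported function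
on the group; a coefficient may vanish, so the support of [al] can be smaller
than the family. *)
Lemma positive_definite_family phi (I : finType) (x : I -> W) (a : I -> R[i]) :
    positive_definite phi -> injective x ->
  0 <= \sum_i \sum_j phi ((x j)^-1 * x i)%g * a i * (a j)^*.
Proof.
move=> pd_phi x_inj; pose X := [fset w in codom x]%fset.
pose al := [fsfun w in X => \sum_(i | x i == w) a i | 0]
  : {fsfun W -> R[i] for fun=> 0}.
have alE i : al (x i) = a i.
  rewrite fsfunE ifT; last by rewrite inE /= codom_f.
  by rewrite (big_pred1 i) // => j /=; apply: inj_eq.
have sumE (F : W -> R[i]) : (forall w, al w = 0 -> F w = 0) ->
    \sum_(w <- finsupp al) F w = \sum_i F (x i).
  move=> F0; rewrite (big_fset_incl _ (finsupp_sub _ _ _)) => [|w _].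
    rewrite -(big_image _ _ _ xpredT F) /=; apply: perm_big; apply: uniq_perm.
    - exact: fset_uniq.
    - by rewrite map_inj_uniq ?enum_uniq.
    by move=> w; rewrite inE.
  by rewrite mem_finsupp negbK => /eqP /F0.
have := pd_phi al; rewrite sumE => [|w al0]; last first.
  by apply: big1 => y _; rewrite al0 mulr0 mul0r.
congr (0 <= _); apply: eq_bigr => i _; rewrite sumE => [|w ->]; last first.
  by rewrite conjC0 mulr0.
by apply: eq_bigr => j _; rewrite !alE.
Qed.

End PositiveDefinite.

(** * Powers of the colour-length *)

Section ColourPower.
Local Open Scope ring_scope.
Context (R : realType) (W : groupType) (S : set W) (m : S -> S -> option nat).
Hypothesis hW : is_coxeter_system m.

(** The conditional probability that the random set of generators, with letters
kept with probability [r], contains the colour of [w] when the letters of [T]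
are known to be excluded, those of [F] are undecided and all others are kept. *)
Definition partial_colour_weight (r : R) (F T : seq S) (w : W) : R[i] :=
  r%:C%C ^+ count (fun s => s \in colour S w) F *
  (all (fun s => s \notin colour S w) T)%:R.

(** Conditioning on whether a letter [s] is kept writes the weight as [r] times
the weight with [s] kept plus [1 - r] times the weight with [s]
excluded.  When all letters are decided, the weight is the indicator function of
the subgroup of elements whose colour avoids [T]. *)
Lemma partial_colour_weight_ge0 (r : R) (F T : seq S) (A : seq W)
    (a : W -> R[i]) :
  0 <= r -> r <= 1 -> 0 <= hermitian_form (partial_colour_weight r F T) A a.
Proof.
move=> r0 r1; elim: F T => [|s F IH] T.
  rewrite (_ : partial_colour_weight r [::] T =
    (fun w => (all (fun s => s \notin colour S w) T)%:R)); last first.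
    by apply/funext => w; rewrite /partial_colour_weight /= mul1r.
  apply: subgroup_form_ge0 => [|x y /allP xT /allP yT|x /allP xT]; apply/allP => s sT.
  - exact: colour1 hW s.
  - by apply/negP => /(colourM hW); rewrite (negbTE (xT s sT)) (negbTE (yT s sT)).
  - by apply/negP => /(colourV hW); apply/negP/xT.
have -> : hermitian_form (partial_colour_weight r (s :: F) T) A a =
    r%:C%C * hermitian_form (partial_colour_weight r F T) A a +
    (1 - r)%:C%C * hermitian_form (partial_colour_weight r F (s :: T)) A a.
  rewrite /hermitian_form !mulr_sumr -big_split; apply: eq_bigr => x _ /=.
  rewrite !mulr_sumr -big_split; apply: eq_bigr => y _ /=.
  rewrite !mulrA -!mulrDl; congr (_ * _ * _).
  rewrite /partial_colour_weight /=; case: (s \in _) => /=.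
    by rewrite !mulr0 addr0 exprS.
  by rewrite -!mulrDl -rmorphD addrC subrK rmorph1 mul1r.
by apply: addr_ge0; apply: mulr_ge0 => //; rewrite lecR ?subr_ge0.
Qed.

Lemma colour_power_positive_definite (r : R) : 0 <= r -> r <= 1 ->
  positive_definite (colour_power S r).
Proof.
move=> r0 r1 al; pose A : seq W := finsupp al.
pose F := undup (flatten [seq reduced_word S (y^-1 * x)%g | x <- A, y <- A]).
have := partial_colour_weight_ge0 F [::] A al r0 r1; congr (0 <= _).
rewrite /hermitian_form big_seq [RHS]big_seq; apply: eq_bigr => x xA.
rewrite big_seq [RHS]big_seq; apply: eq_bigr => y yA.
congr (_ * _ * _); rewrite /partial_colour_weight mulr1 /colour_power rmorphXn.
congr (_ ^+ _); rewrite colour_lengthE -size_filter.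
apply: perm_size; apply: uniq_perm.
- by rewrite filter_uniq ?undup_uniq.
- exact: undup_uniq.
move=> s; rewrite mem_filter /= !mem_undup mem_colour; apply: andb_idr => sxy.
by apply/flattenP; exists (reduced_word S (y^-1 * x)%g) => //; apply: allpairs_f.
Qed.

(** The lower bound comes from the all-ones vector, the upper bound from the
difference of two basis vectors, both eigenvectors of the Gram matrix of the
elements [s_k s_0]. *)
Lemma star_bounds (r : R) (n : nat) (s : 'I_n.+1 -> S) :
    (2 <= n)%N -> injective s ->
    (forall k, k != ord0 ->
       (val (s ord0) * val (s k))%g <> (val (s k) * val (s ord0))%g) ->
    positive_definite (colour_power S r) ->
  - 1 / (n%:R - 1) <= r ^+ 3 /\ r ^+ 3 <= 1.
Proof.
move=> n2 s_inj ncomm pd_r.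
pose x (k : 'I_n) := (val (s (lift ord0 k)) * val (s ord0))%g.
have x_inj : injective x by move=> i j /mulIg /val_inj /s_inj /lift_inj.
have phi_x i j : colour_power S r ((x j)^-1 * x i)%g =
    ((i == j)%:R * (1 - r ^+ 3) + r ^+ 3)%:C%C.
  rewrite /colour_power; congr _%:C%C; have [->|ij] := eqVneq.
    by rewrite mulVg (colour_length1 hW) mul1r subrK.
  rewrite mul0r add0r invgM !(generatorV hW) mulgA (colour_length_star hW) //.
  - by rewrite (inj_eq s_inj) neq_lift.
  - by rewrite (inj_eq s_inj) (inj_eq lift_inj) eq_sym.
  - by apply: ncomm; rewrite eq_sym neq_lift.
have n1 : 0 < n%:R - 1 :> R by rewrite subr_gt0 ltr1n.
split.
  have := positive_definite_family (fun=> 1) pd_r x_inj.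
  under eq_bigr => i _ do under eq_bigr => j _ do rewrite phi_x conjC1 !mulr1.
  under eq_bigr => i _ do rewrite -rmorph_sum big_split /= -mulr_suml.
  rewrite -rmorph_sum lecR.
  rewrite (eq_bigr (fun=> (1 - r ^+ 3) + r ^+ 3 *+ n)) => [|i _]; last first.
    rewrite sumr_const card_ord (bigD1 i) //= eqxx big1 ?addr0 ?mul1r // => j.
    by rewrite eq_sym => /negbTE ->.
  rewrite sumr_const card_ord pmulrn_lge0 ?(ltnW n2) // => ge0.
  rewrite ler_pdivrMr // mulrBr mulr1 mulr_natr -subr_ge0.
  by rewrite opprK -addrA [- _ + 1]addrC addrC.
pose i0 : 'I_n := Ordinal (ltnW n2); pose i1 : 'I_n := Ordinal n2.
have y_inj : injective (fun b : bool => x (if b then i0 else i1)).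
  by move=> [] [] // /x_inj.
have := positive_definite_family (fun b : bool => if b then 1 else -1) pd_r y_inj.
rewrite !big_bool /= !phi_x !eqxx -[i0 == i1]/false -[i1 == i0]/false.
rewrite rmorphN1 conjC1 !(mulr1, mulrN, mulNr) opprK.
rewrite !mul1r !mul0r !add0r subrK.
by rewrite [- _ + _%:C%C]addrC -mulr2n pmulrn_lge0 // subr_ge0 lecR.
Qed.

Lemma infinite_star_bounds (r : R) (s0 : S) :
    infinite_set [set s : S | (val s0 * val s)%g <> (val s * val s0)%g]%classic ->
    positive_definite (colour_power S r) -> 0 <= r /\ r <= 1.
Proof.
move=> /infiniteP /card_leP [f] pd_r.
pose g (k : nat) : S := val (f (SigSub (in_setT k))).
have g_inj : injective g.
  by move=> i j /val_inj /(@inj _ _ _ f) => /(_ (in_setT _) (in_setT _)) [].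
have g_ncomm k : (val s0 * val (g k))%g <> (val (g k) * val s0)%g.
  exact: (set_mem (valP (f (SigSub (in_setT k))))).
have g_neq k : g k <> s0 by move=> gk; apply: (g_ncomm k); rewrite gk.
have bound n : (2 <= n)%N -> - 1 / (n%:R - 1) <= r ^+ 3 /\ r ^+ 3 <= 1.
  move=> n2; pose s (k : 'I_n.+1) : S := if k == ord0 then s0 else g k.
  apply: (@star_bounds r n s) => //.
    move=> i j; rewrite /s; case: eqVneq => [->|_]; case: eqVneq => [->|_] //.
    - by move/esym/g_neq.
    - by move/g_neq.
    - by move/g_inj/val_inj.
  by move=> k k0; rewrite /s eqxx (negbTE k0); apply: g_ncomm.
have r3_1 := (bound 2 isT).2.
have r_ge0 : 0 <= r.
  rewrite leNgt; apply/negP => r_lt0.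
  have r3 : 0 < - r ^+ 3 by rewrite oppr_gt0 exprn_odd_lt0.
  (* If [k > - 1 / r^3] then the lower bound fails for [n = k + 1]. *)
  have := archi_boundP (ltW (_ : 0 < (- r ^+ 3)^-1)); rewrite invr_gt0 => /(_ r3).
  set k := Num.bound _ => kP.
  have k0 : 0 < k%:R :> R by apply: lt_trans kP; rewrite invr_gt0.
  have [] := bound k.+1; first by rewrite ltnS -(ltr0n R).
  rewrite -natr1 addrK ler_pdivrMr // lerNl -mulNr leNgt => /negP[].
  by rewrite -ltr_pdivrMl // mulr1.
by split=> //; rewrite -(@expr_le1 _ 3).
Qed.

End ColourPower.

Theorem proposition6p3 (R : realType) (W : groupType) (S : set W)
    (m : S -> S -> option nat) (hW : is_coxeter_system m) (r : R) :
  (forall (n : nat) (s : 'I_n.+1 -> S),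
      (2 <= n)%N ->
      injective s ->
      (forall k : 'I_n.+1, k != ord0 ->
         (val (s ord0) * val (s k))%g <> (val (s k) * val (s ord0))%g) ->
      positive_definite (colour_power S r) ->
      (- 1 / (n%:R - 1) <= r ^+ 3 /\ r ^+ 3 <= 1)%R) /\
  ((exists s0 : S,
      infinite_set
        [set s : S | (val s0 * val s)%g <> (val s * val s0)%g]%classic) ->
   (positive_definite (colour_power S r) <-> (0 <= r /\ r <= 1)%R)).
Proof.
split=> [n s|[s0 inf_s0]]; first exact: star_bounds hW r n s.
split=> [|[r0 r1]]; first exact: infinite_star_bounds hW r s0 inf_s0.
exact: colour_power_positive_definite hW r r0 r1.
Qed.
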